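(* The ideal $I=(x^4,y^4,z^4,xy^3,xz^3,x^2yz,y^2z^2,y^3z,yz^3)\subset\mathbb{C}[x,y,z]$ fails the SLP at the range $2$ in degree $2$.
   Context: For an artinian homogeneous ideal $I$ in $R=\mathbb{C}[x,y,z]$, put $A=R/I=\bigoplus_jA_j$. For $k\ge1$, $I$ fails the SLP (Strong Lefschetz Property) at the range $k$ in degree $j$ if for every linear form $L$ the multiplication map $\times L^k:A_j\to A_{j+k}$ does not have maximal rank (i.e. is neither injective nor surjective). *)

(* Defs.v *)
From HB Require Import structures.
From mathcomp Require Import all_boot all_algebra.
From mathcomp Require Import boolp classical_sets functions reals.
From mathcomp Require Import complex mpoly.

Set Implicit Arguments.
Unset Strict Implicit.
Unset Printing Implicit Defensive.

Import GRing.Theory.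

Local Open Scope classical_set_scope.
Local Open Scope quotient_scope.
Local Open Scope ring_scope.

(* The library's quotient rings need a boolean ideal predicate, hence the
   classical `[< _ >]. *)
Definition ideal_gen (S : comNzRingType) (s : seq S) : {pred S} :=
  fun p => `[< exists c : 'I_(size s) -> S, p = \sum_(i < size s) c i * s`_i >].

Lemma ideal_gen_closed (S : comNzRingType) (s : seq S) :
  1 \notin ideal_gen s -> idealr_closed (ideal_gen s).
Proof.
move=> s1; split=> //.
  apply/asboolP; exists (fun=> 0).
  by rewrite big1 // => i _; rewrite mul0r.
move=> a u v /asboolP[cu ->] /asboolP[cv ->].
apply/asboolP; exists (fun i => a * cu i + cv i).
rewrite mulr_sumr -big_split /=; apply: eq_bigr => i _.
by rewrite mulrDl mulrA.
Qed.

Lemma ideal_gen_proper (n : nat) (K : comNzRingType) (s : seq {mpoly K[n]}) :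
  all (fun p : {mpoly K[n]} => p@_0%MM == 0) s -> 1 \notin ideal_gen s.
Proof.
move=> /(all_nthP 0) s0; apply/negP => /asboolP[c].
move/(congr1 (mcoeff 0%MM)); rewrite mcoeff1 eqxx raddf_sum /= => /eqP.
rewrite big1 ?oner_eq0 // => i _; rewrite rmorphM /=.
by rewrite (eqP (s0 i (ltn_ord i))) mulr0.
Qed.

Section Lefschetz.
Variables (n : nat) (K : comNzRingType) (I : idealr {mpoly K[n]}).

Local Notation A := {ideal_quot I}.

Definition graded_part (j : nat) : set A :=
  [set \pi_A f | f in [set f : {mpoly K[n]} | f \is j.-homog]].

Definition mulpow (L : {mpoly K[n]}) (k : nat) (a : A) : A :=
  (\pi_A L) ^+ k * a.

Definition has_max_rank (L : {mpoly K[n]}) (k j : nat) : Prop :=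
  set_inj (graded_part j) (mulpow L k)
  \/ set_surj (graded_part j) (graded_part (j + k)) (mulpow L k).

Definition fails_SLP_at_range_in_degree (k j : nat) : Prop :=
  forall L : {mpoly K[n]}, L \is 1.-homog -> ~ has_max_rank L k j.

End Lefschetz.

Section TheIdeal.
Variable R : realType.

Local Notation S := {mpoly R[i][3]}.
Local Notation x := ('X_(inord 0) : S).
Local Notation y := ('X_(inord 1) : S).
Local Notation z := ('X_(inord 2) : S).

Definition gens : seq S :=
  [:: x ^+ 4; y ^+ 4; z ^+ 4; x * y ^+ 3; x * z ^+ 3; x ^+ 2 * y * z;
      y ^+ 2 * z ^+ 2; y ^+ 3 * z; y * z ^+ 3].

Definition idealI_pred : {pred S} := ideal_gen gens.

Lemma idealI_closed : idealr_closed idealI_pred.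
Proof.
apply/ideal_gen_closed/ideal_gen_proper; rewrite /gens.
have X0 (i : 'I_3) : ('X_i : S)@_0%MM = 0 by rewrite mcoeffX mnm1_eq0.
move: (X0 (inord 0)) (X0 (inord 1)) (X0 (inord 2)).
move: 'X_(inord 0) 'X_(inord 1) 'X_(inord 2) => a b c a0 b0 c0.
pose f : {rmorphism S -> R[i]} := mcoeff 0%MM.
have fa : f a = 0 by []. have fb : f b = 0 by []. have fc : f c = 0 by [].
apply/allP => p; rewrite !inE -[p@__]/(f p); move: f fa fb fc => f fa fb fc.
by do ![case/orP|move/eqP->; rewrite ?(rmorphM f) ?(rmorphXn f) ?fa ?fb ?fc
  ?expr0n ?mul0r ?mulr0 ?eqxx //].
Qed.

HB.instance Definition _ := isIdealr.Build S idealI_pred idealI_closed.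

Definition idealI : idealr S := idealI_pred.

End TheIdeal.
Arguments idealI R : clear implicits.

(* Main.v *)
(** Multiplication by [L ^+ 2], where [L = a x + b y + c z], maps the
    6-dimensional space [A_2] to the 6-dimensional space [A_4], whose monomial
    basis is [x^3y, x^3z, x^2y^2, x^2z^2, xy^2z, xyz^2].  The quadric
    [a^2 x^2 + 3 b^2 y^2 + 3 c^2 z^2 - 2ab xy - 2ac xz] is in its kernel, and it
    is nonzero unless [L = 0], in which case [x^2] is in the kernel.  Dually, the
    linear form on [A_4] with coordinates
    [(3bc^2, -3b^2c, -2ac^2, 2ab^2, a^2c, -a^2b)] vanishes on the image; when it
    degenerates to 0, a coordinate form does. *)
Require Import Defs.
From mathcomp Require Import all_boot all_algebra reals complex mpoly.
From mathcomp Require Import boolp classical_sets functions.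
From mathcomp Require Import ring.

Set Implicit Arguments.
Unset Strict Implicit.
Unset Printing Implicit Defensive.

Import GRing.Theory Num.Theory.
Local Open Scope quotient_scope.
Local Open Scope ring_scope.

(** * Failure of injectivity and surjectivity in terms of polynomial representatives *)

Section MaxRank.
Variables (n : nat) (K : comNzRingType) (I : idealr {mpoly K[n]}).
Variables (L : {mpoly K[n]}) (k j : nat).

Lemma mulpow_pi (f : {mpoly K[n]}) :
  mulpow L k (\pi_({ideal_quot I}) f) = \pi_({ideal_quot I}) (L ^+ k * f).
Proof. by rewrite /mulpow rmorphM rmorphXn. Qed.

(** The classes of [f] and of 0 are distinct but have the same image; 0 is homogeneous of every
    degree. *)
Lemma not_set_inj_mulpow (f : {mpoly K[n]}) :
  f \is j.-homog -> f \notin I -> L ^+ k * f \in I ->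
  ~ set_inj (graded_part (I := I) j) (mulpow L k).
Proof.
move=> fj fI LfI inj; apply/negP: fI; rewrite negbK -[f]subr0.
rewrite Quotient.idealrBE; apply/eqP/inj; rewrite ?inE.
- by exists f.
- by exists 0 => //; exact: rpred0.
- by apply/eqP; rewrite !mulpow_pi -Quotient.idealrBE mulr0 subr0.
Qed.

(** A preimage of the class of [t] would lift to a polynomial [f] with [t - L ^+ k * f] in [I]. *)
Lemma not_set_surj_mulpow (t : {mpoly K[n]}) :
  t \is (j + k).-homog -> (forall f, t - L ^+ k * f \notin I) ->
  ~ set_surj (graded_part (I := I) j) (graded_part (j + k)) (mulpow L k).
Proof.
move=> tjk tI /(_ (\pi t)) [|_ [f fj <-]]; first by exists t.
rewrite mulpow_pi => /esym/eqP.
by rewrite -Quotient.idealrBE; apply/negP/tI.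
Qed.

End MaxRank.

(** * Coefficients of polynomials in three variables *)

Lemma mcoeffXM (n : nat) (K : comNzRingType) (i : 'I_n) (p : {mpoly K[n]})
    (m : 'X_{1.. n}) :
  ('X_i * p)@_m = if (0 < m i)%N then p@_(m - U_(i))%MM else 0.
Proof.
rewrite mulrC; case: ifP => mi.
  by rewrite -[in LHS](@submK _ U_(i)%MM m) ?lep1mP -?lt0n// addmC mcoeffMX.
(* Every monomial in the support of a multiple of ['X_i] has positive exponent at [i]. *)
apply: memN_msupp_eq0; rewrite (perm_mem (msuppMX _ _)).
apply/mapP => -[m' _ mE]; move: mi.
by rewrite mE mnmDE mnm1E eqxx.
Qed.

Lemma ord3P (i : 'I_3) : [\/ inord 0 = i, inord 1 = i | inord 2 = i].
Proof.
by case: i => -[|[|[|//]]] hi; [constructor 1|constructor 2|constructor 3];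
  apply: val_inj; rewrite /= inordK.
Qed.

Definition expo (i j k : nat) : 'X_{1.. 3} := [multinom [tuple i; j; k]].

Section ThreeVariables.
Variable K : comNzRingType.
Local Notation S := {mpoly K[3]}.
Local Notation x := ('X_(inord 0) : S).
Local Notation y := ('X_(inord 1) : S).
Local Notation z := ('X_(inord 2) : S).
Implicit Type p : S.

Lemma expo0E i j k : expo i j k (inord 0) = i.
Proof. by rewrite multinomE (tnth_nth 0%N) inordK. Qed.

Lemma expo1E i j k : expo i j k (inord 1) = j.
Proof. by rewrite multinomE (tnth_nth 0%N) inordK. Qed.

Lemma expo2E i j k : expo i j k (inord 2) = k.
Proof. by rewrite multinomE (tnth_nth 0%N) inordK. Qed.

Lemma expo_eq (m : 'X_{1.. 3}) : m = expo (m (inord 0)) (m (inord 1)) (m (inord 2)).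
Proof.
apply/mnmP => i; have [<-|<-|<-] := ord3P i.
- by rewrite expo0E.
- by rewrite expo1E.
- by rewrite expo2E.
Qed.

Lemma inord_inj3 i j : (i < 3)%N -> (j < 3)%N ->
  ((inord i : 'I_3) == inord j) = (i == j).
Proof. by move=> hi hj; rewrite -val_eqE /= !inordK. Qed.

Lemma expo_subx i j k : (expo i j k - U_(inord 0))%MM = expo i.-1 j k.
Proof.
by rewrite [LHS]expo_eq !mnmBE !mnm1E expo0E expo1E expo2E !inord_inj3//= subn1 !subn0.
Qed.

Lemma expo_suby i j k : (expo i j k - U_(inord 1))%MM = expo i j.-1 k.
Proof.
by rewrite [LHS]expo_eq !mnmBE !mnm1E expo0E expo1E expo2E !inord_inj3//= subn1 !subn0.
Qed.

Lemma expo_subz i j k : (expo i j k - U_(inord 2))%MM = expo i j k.-1.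
Proof.
by rewrite [LHS]expo_eq !mnmBE !mnm1E expo0E expo1E expo2E !inord_inj3//= subn1 !subn0.
Qed.

Lemma mcoeff_xM p i j k :
  (x * p)@_(expo i j k) = if (0 < i)%N then p@_(expo i.-1 j k) else 0.
Proof. by rewrite mcoeffXM expo0E expo_subx. Qed.

Lemma mcoeff_yM p i j k :
  (y * p)@_(expo i j k) = if (0 < j)%N then p@_(expo i j.-1 k) else 0.
Proof. by rewrite mcoeffXM expo1E expo_suby. Qed.

Lemma mcoeff_zM p i j k :
  (z * p)@_(expo i j k) = if (0 < k)%N then p@_(expo i j k.-1) else 0.
Proof. by rewrite mcoeffXM expo2E expo_subz. Qed.

Lemma mcoeff1_expo i j k :
  (1 : S)@_(expo i j k) = [&& i == 0, j == 0 & k == 0]%N%:R.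
Proof.
rewrite mcoeff1; congr (nat_of_bool _)%:R; apply/eqP/and3P => [e|[/eqP-> /eqP-> /eqP->]].
  have h l : expo i j k l = 0%N by rewrite e mnm0E.
  by rewrite -{1}(expo0E i j k) -{2}(expo1E i j k) -{3}(expo2E i j k) !h.
by rewrite [RHS]expo_eq !mnm0E.
Qed.

(** As a rewrite bundle, this peels off constants and variables one by one, down to a coefficient of
    a remaining factor or of 1. *)
Definition mcoeff_expoE :=
  (mcoeffD, mcoeffN, mcoeffCM, mcoeff_xM, mcoeff_yM, mcoeff_zM, mcoeff1_expo).

(** * Linear forms, their squares, and the kernel quadric *)

Lemma linear_formE p : p \is 1.-homog ->
  exists a b c, p = a%:MP * x + b%:MP * y + c%:MP * z.
Proof.
move=> p1; exists p@_U_(inord 0), p@_U_(inord 1), p@_U_(inord 2).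
apply/mpolyP => m; rewrite !mcoeffD !mcoeffCM !mcoeffX.
have [/mdeg1P[i /eqP->]|m1] := boolP (mdeg m == 1%N); last first.
  rewrite (dhomog_nemf_coeff p1) //.
  have U i : (U_(i)%MM == m) = false by apply: contraNF m1 => /eqP <-; rewrite mdeg1.
  by rewrite !U !mulr0 !addr0.
have [<-|<-|<-] := ord3P i.
- by rewrite !eq_mnm1 !inord_inj3//= mulr1 !mulr0 !addr0.
- by rewrite !eq_mnm1 !inord_inj3//= mulr1 !mulr0 addr0 add0r.
- by rewrite !eq_mnm1 !inord_inj3//= mulr1 !mulr0 !add0r.
Qed.

Lemma mcoeff_linear_formM (a b c : K) p i j k :
  ((a%:MP * x + b%:MP * y + c%:MP * z) * p)@_(expo i j k) =
    a * (if (0 < i)%N then p@_(expo i.-1 j k) else 0)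
    + b * (if (0 < j)%N then p@_(expo i j.-1 k) else 0)
    + c * (if (0 < k)%N then p@_(expo i j k.-1) else 0).
Proof. by rewrite !mulrDl -!mulrA !mcoeff_expoE. Qed.

(** This is the matrix of multiplication by [L ^+ 2] in the monomial bases of degrees 2 and 4 of the
    quotient; only the quadratic part of [f] enters. *)
Lemma mcoeff_sqr_linear_mul (a b c : K) (f : S) (L := a%:MP * x + b%:MP * y + c%:MP * z) :
  [/\ (L ^+ 2 * f)@_(expo 3 1 0) = a ^+ 2 * f@_(expo 1 1 0) + 2 * a * b * f@_(expo 2 0 0),
      (L ^+ 2 * f)@_(expo 3 0 1) = a ^+ 2 * f@_(expo 1 0 1) + 2 * a * c * f@_(expo 2 0 0),
      (L ^+ 2 * f)@_(expo 2 2 0) =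
        a ^+ 2 * f@_(expo 0 2 0) + b ^+ 2 * f@_(expo 2 0 0) + 2 * a * b * f@_(expo 1 1 0),
      (L ^+ 2 * f)@_(expo 2 0 2) =
        a ^+ 2 * f@_(expo 0 0 2) + c ^+ 2 * f@_(expo 2 0 0) + 2 * a * c * f@_(expo 1 0 1) &
      (L ^+ 2 * f)@_(expo 1 2 1) = 2 * a * b * f@_(expo 0 1 1) + 2 * a * c * f@_(expo 0 2 0)
        + 2 * b * c * f@_(expo 1 1 0) + b ^+ 2 * f@_(expo 1 0 1) /\
      (L ^+ 2 * f)@_(expo 1 1 2) = 2 * a * c * f@_(expo 0 1 1) + 2 * a * b * f@_(expo 0 0 2)
        + 2 * b * c * f@_(expo 1 0 1) + c ^+ 2 * f@_(expo 1 1 0)].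
Proof.
rewrite expr2 -mulrA !mcoeff_linear_formM /=.
by split; [ring..|split; ring].
Qed.

(** Squares are written as products so that every term is a constant times a product of two
    variables. *)
Definition kernel_quadric (a b c : K) : S :=
  (a ^+ 2)%:MP * (x * x) + (3 * b ^+ 2)%:MP * (y * y) + (3 * c ^+ 2)%:MP * (z * z)
  - (2 * a * b)%:MP * (x * y) - (2 * a * c)%:MP * (x * z).

(** Over the complex numbers these three coefficients vanish together only for [a = b = c = 0], so
    they suffice to detect that the quadric is nonzero. *)
Lemma mcoeff_kernel_quadric (a b c : K) (q := kernel_quadric a b c) :
  [/\ q@_(expo 2 0 0) = a ^+ 2, q@_(expo 0 2 0) = 3 * b ^+ 2
    & q@_(expo 0 0 2) = 3 * c ^+ 2].
Proof.
have monoE (e : K) (i j : 'I_3) m :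
    (e%:MP * ('X_i * 'X_j))@_m = e * ((U_(i) + U_(j))%MM == m)%:R.
  by rewrite mcoeffCM -mpolyXD mcoeffX.
have -> : expo 2 0 0 = (U_(inord 0) + U_(inord 0))%MM.
  by rewrite [RHS]expo_eq !mnmDE !mnm1E !inord_inj3.
have -> : expo 0 2 0 = (U_(inord 1) + U_(inord 1))%MM.
  by rewrite [RHS]expo_eq !mnmDE !mnm1E !inord_inj3.
have -> : expo 0 0 2 = (U_(inord 2) + U_(inord 2))%MM.
  by rewrite [RHS]expo_eq !mnmDE !mnm1E !inord_inj3.
rewrite /q /kernel_quadric.
rewrite !mcoeffD !mcoeffN !monoE.
have neq (i j k : 'I_3) : ~~ ((i == k) && (j == k)) -> (U_(i) + U_(j) == U_(k) + U_(k))%MM = false.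
  move=> ijk; apply: contraNF ijk => /eqP/mnmP/(_ k).
  by rewrite !mnmDE !mnm1E eqxx; case: (i == k); case: (j == k).
rewrite !eqxx !neq ?inord_inj3 //.
by split; rewrite !(mulr0, mulr1, oppr0, addr0, add0r).
Qed.

Lemma kernel_quadric_homog (a b c : K) : kernel_quadric a b c \is 2.-homog.
Proof.
have xx (e : K) (i j : 'I_3) : e%:MP * ('X_i * 'X_j) \is 2.-homog.
  rewrite mul_mpolyC dhomogZ // (@dhomogM _ _ _ 1%N _ 1%N) //;
  by rewrite dhomogX /= mdeg1.
by do ![exact: xx|apply: rpredB|apply: rpredD].
Qed.

End ThreeVariables.

Section IdealI.
Variable R : realType.
Local Notation S := {mpoly R[i][3]}.
Local Notation x := ('X_(inord 0) : S).
Local Notation y := ('X_(inord 1) : S).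
Local Notation z := ('X_(inord 2) : S).

(** Only those monomials outside the ideal whose coefficients are used: the three squares in degree
    2 and the basis of degree 4. *)
Definition standard_monomials : seq 'X_{1.. 3} :=
  [:: expo 2 0 0; expo 0 2 0; expo 0 0 2; expo 3 1 0; expo 3 0 1; expo 2 2 0;
      expo 2 0 2; expo 1 2 1; expo 1 1 2].

Lemma mcoeff_idealI (p : S) :
  p \in idealI R -> {in standard_monomials, forall m, p@_m = 0}.
Proof.
move=> /asboolP[c ->] m hm; rewrite raddf_sum big1 // => i _ /=.
have : (gens R)`_i \in gens R by rewrite mem_nth.
move: (gens R)`_i (c i) => g {}c; rewrite !inE.
(* In each of the 81 pairs the generator does not divide the monomial, so peeling off its variables
   exhausts some exponent. *)
do ![case/orP]; move=> /eqP->; rewrite mulrC ?exprS ?expr0 ?mulr1 -?mulrA;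
  move: hm; rewrite !inE; do ![case/orP]; by move=> /eqP->; rewrite !mcoeff_expoE.
Qed.

Lemma idealI_comb (c : 'I_9 -> S) : \sum_(i < 9) c i * (gens R)`_i \in idealI R.
Proof. by apply/asboolP; exists c. Qed.

Lemma kernel_quadric_in_idealI (a b c : R[i]) :
  (a%:MP * x + b%:MP * y + c%:MP * z) ^+ 2 * kernel_quadric a b c \in idealI R.
Proof.
pose A : S := a%:MP; pose B : S := b%:MP; pose C : S := c%:MP.
(* The cofactors are the coefficients of the product at the nine generators, in the order of [gens];
   its other six quartic coefficients cancel. *)
pose d := [:: A ^+ 4; 3 * B ^+ 4; 3 * C ^+ 4; 4 * A * B ^+ 3; 4 * A * C ^+ 3;
  - 6 * A ^+ 2 * B * C; 6 * B ^+ 2 * C ^+ 2; 6 * B ^+ 3 * C; 6 * B * C ^+ 3].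
rewrite (_ : _ * _ = \sum_(i < 9) d`_i * (gens R)`_i); first exact: idealI_comb.
rewrite !big_ord_recr big_ord0 /= /kernel_quadric /A /B /C; ring.
Qed.

Lemma not_set_inj_sqr_linear (L : S) : L \is 1.-homog ->
  ~ set_inj (graded_part (I := idealI R) 2) (mulpow L 2).
Proof.
move=> /linear_formE[a [b [c ->]]].
have [/and3P[/eqP-> /eqP-> /eqP->]|abc0] := boolP [&& a == 0, b == 0 & c == 0].
  apply: (@not_set_inj_mulpow _ _ _ _ _ _ (x ^+ 2)).
  - by rewrite (@dhomogMn _ _ _ 1%N) // dhomogX /= mdeg1.
  - apply/negP => /mcoeff_idealI /(_ (expo 2 0 0)).
    rewrite !inE eqxx -[x ^+ 2]mulr1 expr2 -mulrA !mcoeff_expoE => /(_ isT)/eqP.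
    by rewrite oner_eq0.
  - by rewrite !mul0r !add0r expr2 !mul0r rpred0.
apply: (not_set_inj_mulpow (kernel_quadric_homog a b c)); last first.
  exact: kernel_quadric_in_idealI.
(* If the quadric lay in the ideal, its coefficients at the three squares would vanish, forcing
   [a = b = c = 0]. *)
apply: contraNN abc0 => /mcoeff_idealI h.
have := h (expo 2 0 0); have := h (expo 0 2 0); have := h (expo 0 0 2).
rewrite !inE !eqxx ?orbT => /(_ isT)+ /(_ isT)+ /(_ isT); move: h => _.
have [-> -> ->] := mcoeff_kernel_quadric a b c.
have three_sqr_eq0 (e : R[i]) : 3 * e ^+ 2 = 0 -> e == 0.
  by move=> /eqP; rewrite mulf_eq0 pnatr_eq0 sqrf_eq0.
move=> /three_sqr_eq0-> /three_sqr_eq0-> /eqP.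
by rewrite sqrf_eq0 => ->.
Qed.

(** Modulo the ideal [t] is a multiple of [L ^+ 2], so each form vanishing on the columns of the
    matrix above vanishes on [t]. For [a = 0] the [x^3y] row is zero; for [b = c = 0] the [xy^2z]
    row is. *)
Lemma cokernel_relations (a b c : R[i]) (t f : S) :
  t - (a%:MP * x + b%:MP * y + c%:MP * z) ^+ 2 * f \in idealI R ->
  [/\ 3 * b * c ^+ 2 * t@_(expo 3 1 0) - 3 * b ^+ 2 * c * t@_(expo 3 0 1)
        - 2 * a * c ^+ 2 * t@_(expo 2 2 0) + 2 * a * b ^+ 2 * t@_(expo 2 0 2)
        + a ^+ 2 * c * t@_(expo 1 2 1) - a ^+ 2 * b * t@_(expo 1 1 2) = 0,
      a = 0 -> t@_(expo 3 1 0) = 0 &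
      b = 0 -> c = 0 -> t@_(expo 1 2 1) = 0].
Proof.
move=> /mcoeff_idealI tI.
have E m : m \in standard_monomials ->
    t@_m = ((a%:MP * x + b%:MP * y + c%:MP * z) ^+ 2 * f)@_m.
  by move=> /tI/eqP; rewrite mcoeffB subr_eq0 => /eqP.
have [e1 e2 e3 e4 [e5 e6]] := mcoeff_sqr_linear_mul a b c f.
rewrite !E ?inE ?eqxx ?orbT // e1 e2 e3 e4 e5 e6.
by split=> [|->|-> ->]; ring.
Qed.

Lemma not_set_surj_sqr_linear (L : S) : L \is 1.-homog ->
  ~ set_surj (graded_part (I := idealI R) 2) (graded_part (2 + 2)) (mulpow L 2).
Proof.
move=> /linear_formE[a [b [c ->]]].
have X_homog i j k : (i + (j + k) = 4)%N -> ('X_[expo i j k] : S) \is (2 + 2).-homog.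
  move=> ijk; rewrite dhomogX /= mdegE !big_ord_recl big_ord0 !multinomE.
  by rewrite !(tnth_nth 0%N) /= addn0 ijk.
(* For [a = 0] the [x^3y] coordinate settles every [b] and [c], even if the six-term form is
   nonzero. *)
have [a0|a0] := eqVneq a 0.
  apply: (@not_set_surj_mulpow _ _ _ _ _ _ _ (X_homog 3 1 0 erefl)) => f.
  apply/negP => /cokernel_relations[_ /(_ a0) + _].
  by rewrite mcoeffX => /eqP; rewrite oner_eq0.
have [c0|c0] := eqVneq c 0; last first.
  (* At [xy^2z] the six-term relation reads [a ^+ 2 * c = 0]. *)
  apply: (@not_set_surj_mulpow _ _ _ _ _ _ _ (X_homog 1 2 1 erefl)) => f.
  apply/negP => /cokernel_relations[+ _ _].
  rewrite !mcoeffX /= !(mulr0, mulr1, oppr0, addr0, add0r, subr0) => /eqP.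
  by rewrite mulf_eq0 sqrf_eq0 (negPf a0) (negPf c0).
have [b0|b0] := eqVneq b 0.
  apply: (@not_set_surj_mulpow _ _ _ _ _ _ _ (X_homog 1 2 1 erefl)) => f.
  apply/negP => /cokernel_relations[_ _ /(_ b0 c0)].
  by rewrite mcoeffX => /eqP; rewrite oner_eq0.
(* At [xyz^2] the six-term relation reads [- (a ^+ 2 * b) = 0]. *)
apply: (@not_set_surj_mulpow _ _ _ _ _ _ _ (X_homog 1 1 2 erefl)) => f.
apply/negP => /cokernel_relations[+ _ _].
rewrite !mcoeffX /= !(mulr0, mulr1, oppr0, addr0, add0r, sub0r) => /eqP.
by rewrite oppr_eq0 mulf_eq0 sqrf_eq0 (negPf a0) (negPf b0).
Qed.

End IdealI.

Theorem proposition6p6 (R : realType) :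
  fails_SLP_at_range_in_degree (idealI R) 2 2.
Proof. by move=> L L1 [/not_set_inj_sqr_linear|/not_set_surj_sqr_linear]; apply. Qed.
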